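(* Suppose $\Omega$ is a compact Hausdorff space and $Y$ is a quasi-Banach space with cotype two. Suppose $T:C(\Omega)\to Y$ is a bounded linear operator. Then $T$ is 2-absolutely summing, and hence there is a probability measure $\mu$ on $\Omega$ and a constant $C$ so that $\|Tf\|\le C\|f\|_{L_2(\mu)}$ for all $f\in C(\Omega)$.
   Context: $C(\Omega)$ carries the supremum norm; probability measures on $\Omega$ are Borel. An operator $T:X\to Y$ from a Banach space $X$ to a quasi-Banach space $Y$ is 2-absolutely summing if there is a constant $C$ so that for all $n$ and all $x_1,\dots,x_n\in X$, $$\Bigl(\sum_{i=1}^n\|Tx_i\|^2\Bigr)^{1/2}\le C\max_{x^*\in X^*,\,\|x^*\|\le1}\Bigl(\sum_{i=1}^n|x^*(x_i)|^2\Bigr)^{1/2}.$$ A quasi-Banach space $Y$ has cotype $p$ if there is a constant $C$ so that for all $n$ and all $y_1,\dots,y_n\in Y$, $$\Bigl(\sum_{i=1}^n\|y_i\|^p\Bigr)^{1/p}\le C\ \mathrm{Ave}_{\epsilon_i=\pm1}\Bigl\|\sum_{i=1}^n\epsilon_iy_i\Bigr\|,$$ where the average is over all choices of signs; cotype two means cotype $p$ with $p=2$. *)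

(* Defs.v *)
From HB Require Import structures.
From mathcomp Require Import all_boot all_order all_algebra.
From mathcomp Require Import all_classical all_reals all_analysis.

Set Implicit Arguments.
Unset Strict Implicit.
Unset Printing Implicit Defensive.

From mathcomp Require Import ring lra.

Import Order.TTheory GRing.Theory Num.Theory.
Import numFieldNormedType.Exports.

Local Open Scope classical_set_scope.
Local Open Scope ring_scope.

(* C(Omega): compactness is a parameter of the type because the supremum norm
   is a norm only when continuous functions are bounded. *)
Definition contSpace (R : realType) (Omega : ptopologicalType)
  (cO : compact [set: Omega]) : Type := continuousType Omega R.

Definition contSpace_fun (R : realType) (Omega : ptopologicalType)
  (cO : compact [set: Omega]) (f : contSpace R cO) : Omega -> R := f.
Coercion contSpace_fun : contSpace >-> Funclass.

Section ContSpace.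
Context (R : realType) (Omega : ptopologicalType) (cO : compact [set: Omega]).
Local Notation C := (@contSpace R Omega cO).
Implicit Types f g h : C.

HB.instance Definition _ := Choice.copy C (continuousType Omega R).


Lemma contSpaceP f g : (forall t, f t = g t) -> f = g.
Proof. by move=> fg; apply/continuousEP. Qed.

Lemma contSpace_continuous f : continuous f.
Proof. exact: cts_fun. Qed.

Fact contSpace_add_subproof f g :
  continuous (fun t => f t + g t).
Proof. by move=> t; apply: cvgD; exact: contSpace_continuous. Qed.

Fact contSpace_opp_subproof f : continuous (fun t => - f t).
Proof. by move=> t; apply: cvgN; exact: contSpace_continuous. Qed.

Fact contSpace_scale_subproof (a : R) f :
  continuous (fun t => a * f t).
Proof.
by move=> t; apply: cvgM; [exact: cvg_cst|exact: contSpace_continuous].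
Qed.

Fact contSpace_zero_subproof : continuous (fun _ : Omega => 0 : R).
Proof. by move=> t; exact: cvg_cst. Qed.

Definition contSpace_zero : C :=
  (mkcts contSpace_zero_subproof : continuousType Omega R).
Definition contSpace_add f g : C :=
  (mkcts (@contSpace_add_subproof f g) : continuousType Omega R).
Definition contSpace_opp f : C :=
  (mkcts (@contSpace_opp_subproof f) : continuousType Omega R).
Definition contSpace_scale a f : C :=
  (mkcts (@contSpace_scale_subproof a f) : continuousType Omega R).

Fact contSpace_addA : associative contSpace_add.
Proof. by move=> f g h; apply: contSpaceP => t; exact: addrA. Qed.
Fact contSpace_addC : commutative contSpace_add.
Proof. by move=> f g; apply: contSpaceP => t; exact: addrC. Qed.
Fact contSpace_add0 : left_id contSpace_zero contSpace_add.
Proof. by move=> f; apply: contSpaceP => t; exact: add0r. Qed.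
Fact contSpace_addN : left_inverse contSpace_zero contSpace_opp contSpace_add.
Proof. by move=> f; apply: contSpaceP => t; exact: addNr. Qed.

HB.instance Definition _ := GRing.isZmodule.Build C
  contSpace_addA contSpace_addC contSpace_add0 contSpace_addN.

Fact contSpace_scaleA a b f :
  contSpace_scale a (contSpace_scale b f) = contSpace_scale (a * b) f.
Proof. by apply: contSpaceP => t; exact: mulrA. Qed.
Fact contSpace_scale1 : left_id 1 contSpace_scale.
Proof. by move=> f; apply: contSpaceP => t; exact: mul1r. Qed.
Fact contSpace_scaleDr : right_distributive contSpace_scale +%R.
Proof. by move=> a f g; apply: contSpaceP => t; exact: mulrDr. Qed.
Fact contSpace_scaleDl f : {morph contSpace_scale^~ f : a b / a + b}.
Proof. by move=> a b; apply: contSpaceP => t; exact: mulrDl. Qed.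

HB.instance Definition _ := GRing.Zmodule_isLmodule.Build R C
  contSpace_scaleA contSpace_scale1 contSpace_scaleDr contSpace_scaleDl.

Definition sup_norm f : R := sup [set `|f t| | t in [set: Omega]].

Lemma sup_norm_has_sup f :
  has_sup [set `|f t| | t in [set: Omega]].
Proof.
apply: compact_has_sup; first by exists `|contSpace_fun f point|; exists point.
apply: continuous_compact => //; apply: continuous_subspaceT => t.
by apply: (cvg_norm (@contSpace_continuous f t)).
Qed.

Lemma sup_norm_ub f t : `|f t| <= sup_norm f.
Proof. by apply: (sup_upper_bound (sup_norm_has_sup f)); exists t. Qed.

Lemma sup_norm_le f (M : R) :
  (forall t, `|f t| <= M) -> sup_norm f <= M.
Proof.
move=> fM; apply: ge_sup; first exact: (sup_norm_has_sup f).1.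
by move=> _ [t _ <-].
Qed.

Fact sup_normD f g : sup_norm (f + g) <= sup_norm f + sup_norm g.
Proof.
apply: sup_norm_le => t; apply: (le_trans (ler_normD _ _)).
by apply: lerD; exact: sup_norm_ub.
Qed.

Fact sup_normZ a f : sup_norm (a *: f) = `|a| * sup_norm f.
Proof.
have le1 (b : R) h : sup_norm (b *: h) <= `|b| * sup_norm h.
  apply: sup_norm_le => t; rewrite [contSpace_fun _ _]/(b * h t).
  by rewrite normrM ler_wpM2l// sup_norm_ub.
apply/eqP; rewrite eq_le le1/=.
have [->|a0] := eqVneq a 0.
  by rewrite normr0 mul0r (le_trans _ (sup_norm_ub _ point)).
rewrite -ler_pdivlMl ?normr_gt0//.
by rewrite -normfV -[in leLHS](scalerK a0 f) le1.
Qed.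

Fact sup_norm_eq0 f : sup_norm f = 0 -> f = 0.
Proof.
move=> f0; apply: contSpaceP => t; apply/eqP.
by rewrite -normr_le0 -f0 sup_norm_ub.
Qed.

HB.instance Definition _ :=
  Lmodule_isNormed.Build R C sup_normD sup_normZ sup_norm_eq0.

Lemma contSpace_normE f : `|f| = sup_norm f. Proof. by []. Qed.

Fact contSpace_complete (F : set_system C) :
  ProperFilter F -> cauchy F -> cvg F.
Proof.
move=> FF /cauchy_ballP Fc.
have Fcn (e : R) : 0 < e -> exists2 A, F A &
    forall f h, A f -> A h -> forall t, `|f t - h t| < e.
  move=> e0; have /= [[A B] /= [FA FB] AB] := Fc e e0.
  exists (A `&` B); first exact: filterI.
  move=> f h [Af _] [_ Bh] t; have := AB (f, h) (conj Af Bh).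
  by rewrite -ball_normE /ball_/=; apply/le_lt_trans/(sup_norm_ub (f - h)).
have lc t : cvg ((fun f : C => f t) @ F).
  apply: cauchy_cvg; apply/cauchy_ballP => e e0; have [A FA Ae] := Fcn e e0.
  exists ((fun f : C => f t) @` A, (fun f : C => f t) @` A) => /=.
    by split; apply: (@filterS _ F _ A) => // f Af /=; exists f.
  by move=> [_ _] /= [[f Af <-] [h Ah <-]]; exact: Ae.
pose g t := lim ((fun f : C => f t) @ F).
have gE (e : R) : 0 < e -> exists2 A, F A &
    forall f, A f -> forall t, `|g t - f t| <= e.
  move=> e0; have [A FA Ae] := Fcn e e0; exists A => // f Af t.
  have h1 : (fun h : C => `|h t - f t|) @ F --> `|g t - f t|.
    by apply: cvg_norm; apply: cvgB; [exact: lc|exact: cvg_cst].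
  apply: (cvgr_to_le h1); apply: filterS FA => h Ah.
  by apply: ltW; exact: Ae.
have gc : continuous g.
  move=> t; apply/cvgrPdist_le => e e0.
  have e3 : 0 < e / 3 by rewrite divr_gt0.
  have [A FA Ae] := gE _ e3; have [f Af] := filter_ex FA.
  have /cvgrPdist_le/(_ _ e3) := @contSpace_continuous f t.
  apply: filterS => s fts.
  rewrite (_ : g t - g s = (g t - f t) + (f t - f s) - (g s - f s)); last first.
    by ring.
  apply: (le_trans (ler_normB _ _)).
  rewrite [leRHS](_ : _ = e / 3 + e / 3 + e / 3); last by field.
  apply: lerD; last exact: Ae.
  by apply: (le_trans (ler_normD _ _)); apply: lerD => //; exact: Ae.
apply/cvg_ex; exists ((mkcts gc : continuousType Omega R) : C).
apply/cvgrPdist_le => e e0; have [A FA Ae] := gE _ e0.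
apply: filterS FA => f Af.
by apply: sup_norm_le => t; exact: Ae.
Qed.

HB.instance Definition _ := Uniform_isComplete.Build C contSpace_complete.

End ContSpace.

(* A quasi-Banach space is a pair (Y, q); completeness is sequential, which
   suffices since the topology of a quasi-norm is metrizable. *)
Record quasi_banach_norm (R : realType) (Y : lmodType R) (q : Y -> R) : Prop := {
  qnorm_ge0 : forall y, 0 <= q y ;
  qnorm_eq0 : forall y, q y = 0 -> y = 0 ;
  qnormZ : forall (a : R) y, q (a *: y) = `|a| * q y ;
  qnorm_quasi_triangle :
    exists K : R, forall y z, q (y + z) <= K * (q y + q z) ;
  qnorm_complete : forall u : nat -> Y,
    (forall e : R, 0 < e -> exists N : nat,
       forall m n : nat, (N <= m)%N -> (N <= n)%N -> q (u m - u n) < e) ->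
    exists l : Y, forall e : R, 0 < e -> exists N : nat,
      forall n : nat, (N <= n)%N -> q (u n - l) < e
}.

Definition sign_average (R : realType) (Y : lmodType R) (q : Y -> R)
    (n : nat) (y : 'I_n -> Y) : R :=
  (#|{ffun 'I_n -> bool}|%:R)^-1 *
  \sum_(e : {ffun 'I_n -> bool}) q (\sum_(i < n) (-1) ^+ e i *: y i).

Definition has_cotype (R : realType) (Y : lmodType R) (q : Y -> R) (p : R) :=
  exists C : R, forall (n : nat) (y : 'I_n -> Y),
    (\sum_(i < n) q (y i) `^ p) `^ p^-1 <= C * sign_average q y.

Definition bounded_operator (R : realType) (X : completeNormedModType R)
    (Y : lmodType R) (q : Y -> R) (T : X -> Y) :=
  exists M : R, forall x, q (T x) <= M * `|x|.

(* Linear functionals of norm at most 1; the bound implies continuity. *)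
Definition dual_unit_ball (R : realType) (X : completeNormedModType R) :
    set {scalar X} :=
  [set phi : {scalar X} | forall x, `|phi x| <= `|x|].

(* The set under sup is nonempty (take phi = 0) and bounded above by
   (\sum_i `|x i| ^+ 2)^(1/2); the supremum is a maximum by weak-* compactness
   of the dual unit ball. *)
Definition weak_l2_norm (R : realType) (X : completeNormedModType R)
    (n : nat) (x : 'I_n -> X) : R :=
  sup [set Num.sqrt (\sum_(i < n) `|(phi : {scalar X}) (x i)| ^+ 2)
      | phi in @dual_unit_ball R X].

Definition two_absolutely_summing (R : realType) (X : completeNormedModType R)
    (Y : lmodType R) (q : Y -> R) (T : X -> Y) :=
  exists C : R, forall (n : nat) (x : 'I_n -> X),
    Num.sqrt (\sum_(i < n) q (T (x i)) ^+ 2) <= C * weak_l2_norm x.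

Definition borel_space (Omega : ptopologicalType) :=
  g_sigma_algebraType (@open Omega).
HB.instance Definition _ (Omega : ptopologicalType) :=
  Measurable.on (borel_space Omega).

(* Main.v *)
Require Import Defs.
From HB Require Import structures.
From mathcomp Require Import all_boot all_order all_algebra.
From mathcomp Require Import all_classical all_reals all_analysis.
From mathcomp Require Import measurable_realfun ring lra.
Set Implicit Arguments.
Unset Strict Implicit.
Unset Printing Implicit Defensive.
Import Order.TTheory GRing.Theory Num.Theory.
Import numFieldNormedType.Exports.
Local Open Scope classical_set_scope.
Local Open Scope ring_scope.

(** The proof is an extrapolation argument in the style of Maurey and Pisier.
Let K be the constant of the quasi-triangle inequality, c the cotype 2 constant
and M a bound for T. On C(Omega) the weak l2 norm of a family x is the supremum
over t of (sum_i x_i(t)^2)^(1/2), so T is 2-summing with constant A when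
sum_i q(T x_i)^2 <= A^2 for all families with sum_i x_i^2 <= 1 pointwise
([summing_bound]).

A finite 2-summing constant A improves itself. By Pietsch's theorem
([pietsch_functional], from Hahn-Banach) there is a positive normalised
functional phi with q(T f)^2 <= A^2 phi(f^2). Cut f at height a > 0: the
truncated part has sup norm at most a, and the remainder h satisfies
h^2 <= f^4 / a^2, so
  q(T f) <= K (M a + (A / a) phi(f^4)^(1/2)).
Put f = sum_i e_i x_i and average over the signs e_i. Cotype 2 bounds the average
of the left-hand sides from below, and the average of f^4 is at most
3 (sum_i x_i^2)^2 <= 3. Hence T is 2-summing with constant c K (M a + 2 A / a),
and a = 4 c K makes this A / 2 + 4 c^2 K^2 M ([summing_bound_improve]). Since A is
halved, T is 2-summing with constant 8 c^2 K^2 M + 1, however large A was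
([summing_bound_uniform]).

This presupposes that some constant A exists. It does for T o P, where
P f = sum_u f(u) psi_u for a finite partition of unity psi; such operators have
the same bound M as T, and P f is uniformly close to f for the members f of any
given finite family, so the uniform constant passes to T
([summing_bound_bounded]).

For the measure, a second application of Pietsch's theorem gives phi with
q(T f)^2 <= A^2 phi(f^2). The inner content U |-> sup {phi f : 0 <= f <= 1_U} on
open sets generates an outer measure for which open sets are Caratheodory
measurable. Its restriction mu to the Borel sets is a probability measure with
phi g <= int g dmu for continuous g >= 0, which with g = f^2 is the required
domination. *)

(** * Linear functionals below a sublinear functional *)

Section SublinearFunctionals.
Context {R : realType} {V : lmodType R}.
Implicit Types p : V -> R.

(** Homogeneity is stated as the inequality that constructions have to verify;
applying it to [t^-1] as well gives the equality [sublinearZ]. *)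
Definition sublinear p :=
  (forall x y, p (x + y) <= p x + p y) /\
  (forall t x, 0 < t -> p (t *: x) <= t * p x).

Lemma sublinear0 p : sublinear p -> p 0 = 0.
Proof.
move=> [pD pZ]; apply/eqP; rewrite eq_le; apply/andP; split.
  have := pZ 2^-1 0; rewrite scaler0 => /(_ ltac:(by rewrite invr_gt0)) ?; lra.
by have := pD 0 0; rewrite addr0; lra.
Qed.

Lemma sublinearZ p t x : sublinear p -> 0 <= t -> p (t *: x) = t * p x.
Proof.
move=> sp; rewrite le_eqVlt => /predU1P[<-|t0].
  by rewrite scale0r mul0r sublinear0.
case: sp => _ pZ; apply/eqP; rewrite eq_le pZ//=.
have := pZ t^-1 (t *: x); rewrite invr_gt0 => /(_ t0).
by rewrite scalerA mulVf ?gt_eqF// scale1r ler_pdivlMl.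
Qed.

Lemma sublinear_ge p x : sublinear p -> - p (- x) <= p x.
Proof.
by move=> sp; have := sp.1 x (- x); rewrite subrr (sublinear0 sp); lra.
Qed.

(** Members of the chain are bounded below at [x] by [- p0 (- x)], so the
infimum is finite. It is subadditive because two members that almost attain the
infimum at [x] and at [y] can be replaced by the smaller of the two, which
serves both points at once. *)
Lemma inf_chain_sublinear p0 (A : set (V -> R)) : A !=set0 ->
  (forall p, A p -> sublinear p /\ forall x, p x <= p0 x) ->
  (forall p p', A p -> A p' ->
     (forall x, p x <= p' x) \/ (forall x, p' x <= p x)) ->
  let m := fun x => inf [set p x | p in A] in
  sublinear m /\ forall p, A p -> forall x, m x <= p x.
Proof.
move=> [q0 Aq0] Asub Atot m.
have lb x : has_lbound [set p x | p in A].
  exists (- p0 (- x)) => _ [p Ap <-]; have [sp pp0] := Asub p Ap.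
  by apply: le_trans (sublinear_ge x sp); rewrite lerN2.
have hi x : has_inf [set p x | p in A] by split=> //; exists (q0 x); exists q0.
have mle p : A p -> forall x, m x <= p x.
  by move=> Ap x; apply: ge_inf => //; exists p.
have adh x e : 0 < e -> exists2 p, A p & p x < m x + e.
  by move=> e0; have [_ [p Ap <-] px] := inf_adherent e0 (hi x); exists p.
split=> //; split.
- move=> x y; apply/ler_addgt0Pr => e e0.
  have e20 : 0 < e / 2 by rewrite divr_gt0.
  have [p Ap px] := adh x _ e20; have [p' Ap' p'y] := adh y _ e20.
  have [r [Ar rp rp']] : exists r, [/\ A r, r x <= p x & r y <= p' y].
    by have [pp'|p'p] := Atot _ _ Ap Ap'; [exists p|exists p'].
  have := mle _ Ar (x + y); have := (Asub r Ar).1.1 x y.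
  by lra.
- move=> t x t0; rewrite -ler_pdivrMl//; apply: lb_le_inf.
    by exists (q0 x); exists q0.
  move=> _ [p Ap <-]; rewrite ler_pdivrMl//.
  exact: le_trans (mle _ Ap _) ((Asub _ Ap).1.2 _ _ t0).
Qed.

(** For fixed [y], the functional z |-> inf over t >= 0 of p (z + t y) - t p y
is sublinear and lies below [p] (take t = 0). Minimality makes it equal to [p],
and t = 1 then gives the superadditivity p x + p y <= p (x + y). *)
Lemma minimal_sublinearD p : sublinear p ->
  (forall p', sublinear p' -> (forall x, p' x <= p x) -> p' = p) ->
  {morph p : x y / x + y}.
Proof.
move=> sp pmin x y; apply/eqP; rewrite eq_le sp.1/=.
pose D z := [set p (z + t *: y) - t * p y | t in [set t | 0 <= t]].
pose m z := inf (D z).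
have lb z : has_lbound (D z).
  exists (- p (- z)) => _ [t /= t0 <-].
  rewrite -(sublinearZ _ sp)//.
  by have := sp.1 (z + t *: y) (- z); rewrite addrAC subrr add0r; lra.
have hi z : has_inf (D z).
  by split => //; exists (p (z + 0 *: y) - 0 * p y); exists 0 => //=.
have mle z t : 0 <= t -> m z <= p (z + t *: y) - t * p y.
  by move=> t0; apply: ge_inf => //; exists t.
have adh z e : 0 < e -> exists2 t, 0 <= t & p (z + t *: y) - t * p y < m z + e.
  by move=> e0; have [_ [t t0 <-] tz] := inf_adherent e0 (hi z); exists t.
suff mp : m = p.
  by have := mle x 1 ler01; rewrite mp scale1r mul1r; lra.
apply: pmin; last first.
  by move=> z; have := mle z 0 (lexx _); rewrite scale0r addr0 mul0r subr0.
split.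
- move=> u v; apply/ler_addgt0Pr => e e0.
  have e20 : 0 < e / 2 by rewrite divr_gt0.
  have [s s0 su] := adh u _ e20; have [t t0 tv] := adh v _ e20.
  have := mle (u + v) (s + t) (addr_ge0 s0 t0).
  have := sp.1 (u + s *: y) (v + t *: y).
  by rewrite addrACA -scalerDl; lra.
- move=> c z c0; rewrite -ler_pdivrMl//; apply: lb_le_inf; first exact: (hi z).1.
  move=> _ [t /= t0 <-]; rewrite ler_pdivrMl//.
  have := mle (c *: z) (c * t) (mulr_ge0 (ltW c0) t0).
  by rewrite -scalerA -scalerDr (sublinearZ _ sp (ltW c0)) mulrBr mulrA.
Qed.

(** A form of the Hahn-Banach theorem. Zorn's lemma is applied to the everywhere
defined sublinear functionals below [p0], ordered downwards, instead of
partially defined linear ones: a minimal one is additive, hence linear. *)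
Lemma sublinear_dominates_linear p0 : sublinear p0 ->
  exists phi : {scalar V}, forall x, phi x <= p0 x.
Proof.
move=> sp0.
pose S := {p : V -> R | sublinear p /\ forall x, p x <= p0 x}.
pose mk p sp pp0 : S := exist _ p (conj sp pp0).
pose r (p p' : S) : bool := `[< forall x, sval p' x <= sval p x >].
have [||||[p [sp pp0]] pmin] := @Zorn S r.
- by move=> p; apply/asboolP.
- move=> p1 p2 p3 /asboolP h1 /asboolP h2; apply/asboolP => x.
  exact: le_trans (h2 x) (h1 x).
- move=> [p hp] [p' hp'] /asboolP/= h /asboolP/= h'.
  by apply: eq_exist; apply/funext => x; apply/eqP; rewrite eq_le h h'.
- move=> A Atot; have [->|/set0P[q Aq]] := eqVneq A set0.
    by exists (mk p0 sp0 (fun x => lexx (p0 x))).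
  pose B := [set sval p | p in A].
  have [|||sm mle] := @inf_chain_sublinear p0 B.
  + by exists (sval q); exists q.
  + by move=> _ [p Ap <-]; exact: (svalP p).
  + move=> _ _ [p Ap <-] [p' Ap' <-].
    by have [/asboolP|/asboolP] := Atot _ _ Ap Ap'; [right|left].
  + have mp0 x : inf [set p x | p in B] <= p0 x.
      by apply: le_trans ((svalP q).2 x); apply: mle; exists q.
    exists (mk _ sm mp0) => p Ap; apply/asboolP => x /=.
    by apply: mle; exists p.
have pD : {morph p : x y / x + y}.
  apply: (minimal_sublinearD sp) => p' sp' p'p.
  have p'p0 x : p' x <= p0 x by exact: le_trans (p'p x) (pp0 x).
  have := pmin (mk p' sp' p'p0).
  by move=> /(_ ltac:(exact/asboolP)) /(congr1 sval).
have pN x : p (- x) = - p x.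
  by apply/eqP; rewrite -addr_eq0 -pD addNr (sublinear0 sp).
have plin : linear_for *%R p.
  move=> c x y; rewrite pD; congr (_ + _).
  have [c0|c0] := leP 0 c; first exact: sublinearZ.
  by rewrite -[c]opprK scaleNr pN sublinearZ ?mulNr// oppr_ge0 ltW.
pose L := GRing.isLinear.Build R V R *%R p plin.
pose phi : {scalar V} := HB.pack p L.
by exists phi => x; exact: pp0.
Qed.

End SublinearFunctionals.

(** * Operations on continuous functions, states and Pietsch's theorem *)

(* Values [f t] stay folded under simplification, so that the equations collected
in [contSpaceE] keep applying to them. *)
Arguments contSpace_fun : simpl never.

Section ContinuousFunctions.
Context {R : realType} {Omega : ptopologicalType} {cO : compact [set: Omega]}.
Local Notation C := (contSpace R cO).
Implicit Types (f g : C) (phi : {scalar C}).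

Lemma contSpace0E t : contSpace_fun (0 : C) t = 0. Proof. by []. Qed.
Lemma contSpaceDE f g t : contSpace_fun (f + g) t = f t + g t. Proof. by []. Qed.
Lemma contSpaceNE f t : contSpace_fun (- f) t = - f t. Proof. by []. Qed.
Lemma contSpaceZE a f t : contSpace_fun (a *: f) t = a * f t. Proof. by []. Qed.

Lemma contSpace_sumE I (r : seq I) (P : pred I) (F : I -> C) t :
  contSpace_fun (\sum_(i <- r | P i) F i) t = \sum_(i <- r | P i) F i t.
Proof. by elim/big_rec2: _ => // i a b _ <-. Qed.

Definition contSpace_of (f : Omega -> R) (cf : continuous f) : C :=
  (mkcts cf : continuousType Omega R).

Fact contSpace_cst_subproof (a : R) : continuous (fun _ : Omega => a).
Proof. by move=> t; exact: cvg_cst. Qed.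
Definition contSpace_cst a : C := contSpace_of (@contSpace_cst_subproof a).

Fact contSpace_mul_subproof f g : continuous (fun t => f t * g t).
Proof. by move=> t; apply: cvgM; exact: contSpace_continuous. Qed.
Definition contSpace_mul f g : C := contSpace_of (@contSpace_mul_subproof f g).

Fact contSpace_max_subproof f g : continuous (fun t => Num.max (f t) (g t)).
Proof. by move=> t; apply: continuous_max; exact: contSpace_continuous. Qed.
Definition contSpace_max f g : C := contSpace_of (@contSpace_max_subproof f g).

Fact contSpace_min_subproof f g : continuous (fun t => Num.min (f t) (g t)).
Proof. by move=> t; apply: continuous_min; exact: contSpace_continuous. Qed.
Definition contSpace_min f g : C := contSpace_of (@contSpace_min_subproof f g).

Lemma contSpace_ofE (f : Omega -> R) (cf : continuous f) t :
  contSpace_fun (contSpace_of cf) t = f t.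
Proof. by []. Qed.

Lemma contSpace_cstE a t : contSpace_fun (contSpace_cst a) t = a.
Proof. by []. Qed.

Lemma contSpace_mulE f g t : contSpace_fun (contSpace_mul f g) t = f t * g t.
Proof. by []. Qed.

Lemma contSpace_maxE f g t :
  contSpace_fun (contSpace_max f g) t = Num.max (f t) (g t).
Proof. by []. Qed.

Lemma contSpace_minE f g t :
  contSpace_fun (contSpace_min f g) t = Num.min (f t) (g t).
Proof. by []. Qed.

Definition contSpaceE := (contSpace0E, contSpaceDE, contSpaceNE, contSpaceZE,
  contSpace_ofE,
  contSpace_cstE, contSpace_mulE, contSpace_maxE, contSpace_minE).

(** States stand for integration against probability measures until a measure is
constructed. *)
Definition is_state phi :=
  (forall g, (forall t, 0 <= g t) -> 0 <= phi g) /\ phi (contSpace_cst 1) = 1.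

Lemma state_le phi f g : is_state phi -> (forall t, f t <= g t) ->
  phi f <= phi g.
Proof.
move=> [phi0 _] fg; rewrite -subr_ge0 -linearB; apply: phi0 => t.
by rewrite contSpaceDE contSpaceNE subr_ge0.
Qed.

Lemma state_cst phi a : is_state phi -> phi (contSpace_cst a) = a.
Proof.
move=> [_ phi1]; rewrite -[RHS]mulr1 -phi1.
rewrite (_ : contSpace_cst a = a *: contSpace_cst 1) ?linearZ//.
by apply: contSpaceP => t; rewrite !contSpaceE mulr1.
Qed.

End ContinuousFunctions.

Section Pietsch.
Context {R : realType} {Omega : ptopologicalType} {cO : compact [set: Omega]}.
Local Notation C := (contSpace R cO).
Context {Y : lmodType R} {q : Y -> R} (qY : quasi_banach_norm q).
Implicit Types (s : seq C) (T : {linear C -> Y}).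

Lemma quasi_norm0 : q 0 = 0.
Proof. by rewrite -[in LHS](scale0r 0) (qnormZ qY) normr0 mul0r. Qed.

(** The 2-summing inequality with constant [A], normalised to families of weak
l2 norm at most 1. Families are sequences so that they can be concatenated. *)
Definition summing_bound (T : C -> Y) (A : R) := forall s,
  (forall t, \sum_(x <- s) x t ^+ 2 <= 1) ->
  \sum_(x <- s) q (T x) ^+ 2 <= A ^+ 2.

Lemma summing_boundZ T A s L : summing_bound T A ->
  (forall t, \sum_(x <- s) x t ^+ 2 <= L) ->
  \sum_(x <- s) q (T x) ^+ 2 <= A ^+ 2 * L.
Proof.
move=> TA sL.
have : 0 <= L.
  by apply: le_trans (sL point); apply: sumr_ge0 => x _; exact: sqr_ge0.
rewrite le_eqVlt => /predU1P[L0|L0].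
  (* All members of [s] vanish identically. *)
  rewrite -L0 mulr0 big_seq big1// => x xs.
  suff -> : x = 0 by rewrite linear0 quasi_norm0 expr0n.
  apply: contSpaceP => t; apply/eqP; rewrite -sqrf_eq0 eq_le sqr_ge0 andbT.
  rewrite L0; apply: le_trans (sL t); rewrite (big_rem x)//= lerDl.
  by apply: sumr_ge0 => y _; exact: sqr_ge0.
pose c := (Num.sqrt L)^-1.
have c2 : c ^+ 2 = L^-1 by rewrite exprVn sqr_sqrtr// ltW.
have TcE : \sum_(x <- [seq c *: x | x <- s]) q (T x) ^+ 2 =
    L^-1 * \sum_(x <- s) q (T x) ^+ 2.
  rewrite big_map mulr_sumr; apply: eq_bigr => x _.
  by rewrite linearZ (qnormZ qY) exprMn real_normK ?num_real// c2.
have := TA [seq c *: x | x <- s]; rewrite TcE ler_pdivrMl// mulrC; apply => t.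
rewrite big_map; under eq_bigr do rewrite contSpaceZE exprMn c2.
by rewrite -mulr_sumr ler_pdivrMl// mulr1.
Qed.

(** Let p g be the infimum of the c such that g + sum_(x <- s) (A^2 x^2 - q(T
x)^2) <= c pointwise for some family s. The summing bound says exactly that
these sums are never uniformly negative, so p is finite; p is sublinear because
families can be concatenated and rescaled. A linear functional phi below p is at
most sup g at g, hence a state, and the family s = [:: f] shows that phi (q(T
f)^2 - A^2 f^2) <= 0. *)
Lemma pietsch_functional T A : 0 < A -> summing_bound T A ->
  exists2 phi : {scalar C}, is_state phi &
    forall f, q (T f) ^+ 2 <= A ^+ 2 * phi (contSpace_mul f f).
Proof.
move=> A0 TA.
pose d (x : C) t := A ^+ 2 * x t ^+ 2 - q (T x) ^+ 2.
pose D (g : C) :=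
  [set c : R | exists s, forall t, g t + \sum_(x <- s) d x t <= c].
have d_ge s c : (forall t, \sum_(x <- s) d x t <= c) -> 0 <= c.
  move=> sc; rewrite leNgt; apply/negP => c0.
  have : \sum_(x <- s) q (T x) ^+ 2 <=
      A ^+ 2 * ((\sum_(x <- s) q (T x) ^+ 2 + c) / A ^+ 2).
    apply: summing_boundZ => // t.
    rewrite ler_pdivlMr ?exprn_gt0// mulrC mulr_sumr.
    by have := sc t; rewrite sumrB; lra.
  by rewrite mulrC divfK ?expf_neq0 ?gt_eqF//; lra.
have D_lb (g : C) a c : (forall t, a <= g t) -> D g c -> a <= c.
  move=> ag [s gs]; rewrite -subr_ge0; apply: (@d_ge s) => t.
  by have := gs t; have := ag t; lra.
have D_norm g : D g `|g|.
  exists [::] => t; rewrite big_nil addr0; apply: le_trans (ler_norm _) _.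
  exact: sup_norm_ub.
have norm_le (g : C) t : - `|g| <= g t.
  rewrite lerNl; apply: le_trans (ler_norm _) _; rewrite normrN.
  exact: sup_norm_ub.
have D_hi g : has_inf (D g).
  split; first by exists `|g|; exact: D_norm.
  by exists (- `|g|) => c; apply: D_lb => t.
pose p g := inf (D g).
have p_le g c : D g c -> p g <= c by apply: ge_inf; exact: (D_hi g).2.
have p_sup (g : C) c : (forall t, g t <= c) -> p g <= c.
  by move=> gc; apply: p_le; exists [::] => t; rewrite big_nil addr0.
have adh g e : 0 < e -> exists2 c, D g c & c < p g + e.
  by move=> e0; exact: inf_adherent e0 (D_hi g).
have psub : sublinear p.
  split=> [f g|c f c0].
    apply/ler_addgt0Pr => e e0.
    have e20 : 0 < e / 2 by rewrite divr_gt0.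
    have [a [s fs] ap] := adh f _ e20; have [b [r gr] bp] := adh g _ e20.
    suff : p (f + g) <= a + b by lra.
    apply: p_le; exists (s ++ r) => t; rewrite contSpaceDE big_cat/=.
    by have := fs t; have := gr t; lra.
  rewrite -ler_pdivrMl//; apply: lb_le_inf; first exact: (D_hi f).1.
  move=> a [s fs]; rewrite ler_pdivrMl//; apply: p_le.
  have dZ x t : d (Num.sqrt c *: x) t = c * d x t.
    rewrite /d contSpaceE [T _]linearZ (qnormZ qY) !exprMn real_normK ?num_real//.
    by rewrite sqr_sqrtr ?(ltW c0)// mulrBr mulrCA.
  exists [seq Num.sqrt c *: x | x <- s] => t; rewrite big_map contSpaceE.
  under eq_bigr do rewrite dZ.
  by rewrite -mulr_sumr -mulrDr ler_wpM2l ?(ltW c0).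
have [phi phip] := sublinear_dominates_linear psub.
have phi_sup (g : C) c : (forall t, g t <= c) -> phi g <= c.
  by move=> gc; apply: le_trans (phip g) (p_sup _ _ gc).
have phi1 : phi (contSpace_cst 1) = 1.
  apply/eqP; rewrite eq_le phi_sup//= -lerN2 -linearN.
  by apply: phi_sup => t; rewrite contSpaceE.
exists phi.
  split=> // g g0; rewrite -oppr_le0 -linearN; apply: phi_sup => t.
  by rewrite contSpaceNE oppr_le0.
move=> f.
pose h : C := contSpace_cst (q (T f) ^+ 2) - A ^+ 2 *: contSpace_mul f f.
have : phi h <= 0.
  apply: le_trans (phip h) (p_le _ _ _); exists [:: f] => t.
  by rewrite big_seq1 /d !contSpaceE expr2; lra.
rewrite /h linearB linearZ/=.
rewrite (_ : contSpace_cst _ = q (T f) ^+ 2 *: contSpace_cst 1); last first.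
  by apply: contSpaceP => t; rewrite !contSpaceE mulr1.
by rewrite linearZ/= phi1 mulr1 subr_le0.
Qed.

End Pietsch.

(** * Moments of Rademacher sums *)

Section RademacherMoments.
Context {R : realFieldType} {I : finType}.
Implicit Types (x : I -> R) (e : {ffun I -> bool}) (r : seq I).

Definition rademacher_sum x r e : R := \sum_(i <- r) (-1) ^+ e i * x i.

(** Flipping one sign permutes the sign vectors. Averaging a sum over signs with
its image under the flip cancels the odd powers of one summand, which replaces
the expansion into mixed moments. *)
Definition flip_sign (i : I) e : {ffun I -> bool} :=
  [ffun j => e j (+) (j == i)].

Lemma flip_signK i : involutive (flip_sign i).
Proof. by move=> e; apply/ffunP => j; rewrite !ffunE addbK. Qed.

Lemma sum_flip_sign i (F : {ffun I -> bool} -> R) :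
  \sum_e F e = 2^-1 * \sum_e (F e + F (flip_sign i e)).
Proof.
rewrite big_split/= [X in _ + X](_ : _ = \sum_e F e); last first.
  by rewrite [RHS](reindex_inj (inv_inj (flip_signK i))).
by field.
Qed.

Lemma rademacher_sum_flip x r i e : i \notin r ->
  rademacher_sum x r (flip_sign i e) = rademacher_sum x r e.
Proof.
move=> ir; apply: eq_big_seq => j jr; rewrite ffunE.
by have [ji|] := eqVneq j i; [rewrite -ji jr in ir|rewrite addbF].
Qed.

Lemma rademacher_sum_cons x r i e :
  rademacher_sum x (i :: r) e = rademacher_sum x r e + (-1) ^+ e i * x i.
Proof. by rewrite /rademacher_sum big_cons addrC. Qed.

Lemma rademacher_sum_cons_flip x r i e : i \notin r ->
  rademacher_sum x (i :: r) (flip_sign i e) =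
  rademacher_sum x r e - (-1) ^+ e i * x i.
Proof.
move=> ir; rewrite rademacher_sum_cons rademacher_sum_flip// ffunE eqxx.
by rewrite addbT; case: (e i); rewrite /= ?expr0 ?expr1 ?mulN1r ?mul1r ?opprK.
Qed.

Local Notation N := (#|{ffun I -> bool}|%:R : R).

Lemma sum_cst_signs (a : R) : \sum_(e : {ffun I -> bool}) a = a * N.
Proof. by rewrite sumr_const mulr_natr. Qed.

Lemma rademacher_second_moment x r : uniq r ->
  \sum_e rademacher_sum x r e ^+ 2 = (\sum_(i <- r) x i ^+ 2) * N.
Proof.
elim: r => [_|i r IH /= /andP[ir ur]].
  rewrite big_nil mul0r big1// => e _; rewrite /rademacher_sum big_nil.
  by rewrite expr0n.
rewrite (sum_flip_sign i) big_cons mulrDl -(IH ur) addrC -sum_cst_signs.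
rewrite -big_split/= mulr_sumr; apply: eq_bigr => e _.
rewrite rademacher_sum_cons_flip// rademacher_sum_cons.
by case: (e i); rewrite /= ?expr0 ?expr1; field.
Qed.

(** Adding a term a to a Rademacher sum S changes the mean of S^4 by the means
of 6 a^2 S^2 and a^4, and 3 s^2 + 6 a^2 s + a^4 <= 3 (s + a^2)^2 for s the mean
of S^2. *)
Lemma rademacher_fourth_moment x r : uniq r ->
  \sum_e rademacher_sum x r e ^+ 4 <= 3 * (\sum_(i <- r) x i ^+ 2) ^+ 2 * N.
Proof.
elim: r => [_|i r IH /= /andP[ir ur]].
  rewrite big_nil expr0n mulr0 mul0r big1// => e _.
  by rewrite /rademacher_sum big_nil expr0n.
have -> : \sum_e rademacher_sum x (i :: r) e ^+ 4 =
    \sum_e rademacher_sum x r e ^+ 4 +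
    6 * x i ^+ 2 * \sum_e rademacher_sum x r e ^+ 2 + x i ^+ 4 * N.
  rewrite (sum_flip_sign i) -sum_cst_signs !mulr_sumr -!big_split/=.
  apply: eq_bigr => e _.
  rewrite rademacher_sum_cons_flip// rademacher_sum_cons.
  by case: (e i); rewrite /= ?expr0 ?expr1; field.
rewrite rademacher_second_moment// big_cons.
have N0 : 0 <= N by rewrite ler0n.
have := IH ur; set s := \sum_(j <- r) _; set S := \sum_e _ => Ss.
have := mulr_ge0 (exprn_even_ge0 (x i) (isT : ~~ odd 4)) N0.
rewrite (_ : 3 * (x i ^+ 2 + s) ^+ 2 * N =
  3 * s ^+ 2 * N + 6 * x i ^+ 2 * (s * N) + 3 * (x i ^+ 4 * N)); last by ring.
lra.
Qed.

End RademacherMoments.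

(** * Extrapolation *)

Section QuasiNorms.
Context {R : realType} {Y : lmodType R} {q : Y -> R}.
Implicit Types y z : Y.

Lemma quasi_triangle_ge1 : quasi_banach_norm q ->
  exists2 K : R, 1 <= K & forall y z, q (y + z) <= K * (q y + q z).
Proof.
move=> qY; have [K Kq] := qnorm_quasi_triangle qY; exists (Num.max 1 K).
  by rewrite le_max lexx.
move=> y z; apply: le_trans (Kq y z) _; rewrite ler_wpM2r ?le_max ?lexx ?orbT//.
by apply: addr_ge0; exact: (qnorm_ge0 qY).
Qed.

(** The factor [K ^+ size r] is crude. The lemma only serves to show that some
constant exists for finite-rank operators, and its value does not enter the
final bounds. *)
Lemma quasi_norm_sum (qY : quasi_banach_norm q) (K : R) (I : Type) (r : seq I)
    (F : I -> Y) : 1 <= K -> (forall y z, q (y + z) <= K * (q y + q z)) ->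
  q (\sum_(i <- r) F i) <= K ^+ size r * \sum_(i <- r) q (F i).
Proof.
move=> K1 Kq; elim: r => [|i r IH]; first by rewrite !big_nil quasi_norm0// mulr0.
rewrite !big_cons exprS -mulrA; apply: le_trans (Kq _ _) _.
rewrite ler_wpM2l ?(le_trans ler01)// mulrDr lerD// ler_peMl ?(qnorm_ge0 qY)//.
exact: exprn_ege1.
Qed.

Lemma cotype2_sum_sqr : quasi_banach_norm q -> has_cotype q 2 ->
  exists2 c : R, 0 < c & forall n (y : 'I_n -> Y),
    \sum_(i < n) q (y i) ^+ 2 <= (c * sign_average q y) ^+ 2.
Proof.
move=> qY [c0 cq]; exists (Num.max 1 c0); first by rewrite lt_max ltr01.
move=> n y.
have avg0 : 0 <= sign_average q y.
  rewrite /sign_average mulr_ge0 ?invr_ge0 ?ler0n//.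
  by apply: sumr_ge0 => e _; exact: (qnorm_ge0 qY).
have S0 : 0 <= \sum_(i < n) q (y i) ^+ 2.
  by apply: sumr_ge0 => i _; exact: sqr_ge0.
have := cq n y; under eq_bigr do rewrite powR_mulrn ?(qnorm_ge0 qY)//.
rewrite powR12_sqrt// => Sle.
rewrite -(sqr_sqrtr S0) ler_pXn2r ?nnegrE ?sqrtr_ge0//; last first.
  by rewrite mulr_ge0// le_max ler01.
by apply: le_trans Sle _; rewrite ler_wpM2r// le_max lexx orbT.
Qed.

End QuasiNorms.

Section Extrapolation.
Context {R : realType} {Omega : ptopologicalType} {cO : compact [set: Omega]}.
Local Notation C := (contSpace R cO).
Context {Y : lmodType R} {q : Y -> R} (qY : quasi_banach_norm q).
Context {K c M : R} (K1 : 1 <= K) (c0 : 0 < c) (M0 : 0 < M).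
Hypothesis Kq : forall y z, q (y + z) <= K * (q y + q z).
Hypothesis cq : forall n (y : 'I_n -> Y),
  \sum_(i < n) q (y i) ^+ 2 <= (c * sign_average q y) ^+ 2.
Implicit Types (s : seq C) (T : {linear C -> Y}) (f : C).

Definition sup_bounded (T : C -> Y) := forall f b,
  (forall t, `|f t| <= b) -> q (T f) <= M * b.

Definition truncate (a : R) f : C :=
  contSpace_max (contSpace_cst (- a)) (contSpace_min (contSpace_cst a) f).

Lemma truncate_le a f t : 0 <= a -> `|truncate a f t| <= a.
Proof.
move=> a0; rewrite /truncate !contSpaceE ler_norml le_max lexx/=.
by rewrite ge_max ge_min lexx /= andbT; lra.
Qed.

(** Where the remainder is nonzero, [a <= `|f t|] and the remainder is at most
[`|f t|] in absolute value. *)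
Lemma truncate_remainder_le a f t : 0 < a ->
  (f t - truncate a f t) ^+ 2 <= (f t ^+ 2) ^+ 2 / a ^+ 2.
Proof.
move=> a0; rewrite /truncate !contSpaceE ler_pdivlMr ?exprn_gt0//.
rewrite -exprMn -[leLHS]real_normK ?num_real// ler_pXn2r ?nnegrE ?sqr_ge0//.
rewrite normrM (gtr0_norm a0); move: (f t) => x.
have [ax|xa] := leP a x.
  have [_|] := leP (- a) a; last by lra.
  by rewrite ger0_norm ?subr_ge0//; nra.
have [ax|xa'] := leP (- a) x; first by rewrite subrr normr0 mul0r sqr_ge0.
by rewrite ltr0_norm; nra.
Qed.

Definition fourth_power f : C :=
  contSpace_mul (contSpace_mul f f) (contSpace_mul f f).

Lemma fourth_powerE f t : fourth_power f t = f t ^+ 4.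
Proof. by rewrite !contSpaceE; ring. Qed.

(** The sup-norm bound controls the truncated part and the state controls the
remainder. The square root of u = phi (f^4) is replaced by (1 + u) / 2, which is
affine in u and therefore can be averaged over signs. *)
Lemma truncation_bound T A a (phi : {scalar C}) f :
  0 < A -> 0 < a -> sup_bounded T -> is_state phi ->
  (forall g, q (T g) ^+ 2 <= A ^+ 2 * phi (contSpace_mul g g)) ->
  q (T f) <= K * (M * a + A / a * ((1 + phi (fourth_power f)) / 2)).
Proof.
move=> A0 a0 TM st Tphi; set u := phi _.
have u0 : 0 <= u.
  by apply: st.1 => t; rewrite fourth_powerE exprn_even_ge0.
pose h := f - truncate a f.
rewrite -[f in q (T f)](subrK (truncate a f)) addrC linearD.
apply: le_trans (Kq _ _) _; rewrite ler_wpM2l ?(le_trans ler01)// lerD//.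
  by apply: TM => t; apply: truncate_le; exact: ltW.
rewrite -(ler_pXn2r (isT : (0 < 2)%N)) ?nnegrE ?(qnorm_ge0 qY)//; last first.
  by apply: mulr_ge0; [rewrite divr_ge0 ?ltW|lra].
apply: le_trans (Tphi _) _.
have hu : phi (contSpace_mul h h) <= u / a ^+ 2.
  rewrite mulrC (_ : _ * u = phi (a ^- 2 *: fourth_power f)); last first.
    by rewrite linearZ.
  apply: state_le => // t.
  rewrite contSpaceE contSpaceZE fourth_powerE -expr2 mulrC (exprM _ 2 2).
  by rewrite contSpaceDE contSpaceNE; exact: truncate_remainder_le.
rewrite [leRHS](_ : _ = A ^+ 2 * (((1 + u) / 2) ^+ 2 / a ^+ 2)); last first.
  by field; exact: lt0r_neq0.
rewrite ler_wpM2l ?sqr_ge0//; apply: le_trans hu _.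
rewrite ler_wpM2r ?invr_ge0 ?sqr_ge0//.
by have := sqr_ge0 (1 - u); rewrite !expr2; lra.
Qed.

Lemma state_average_fourth_power (phi : {scalar C}) n (x : 'I_n -> C) :
  is_state phi -> (forall t, \sum_(i < n) x i t ^+ 2 <= 1) ->
  \sum_(e : {ffun 'I_n -> bool})
    phi (fourth_power (\sum_(i < n) (-1) ^+ e i *: x i)) <=
  3 * #|{ffun 'I_n -> bool}|%:R.
Proof.
move=> st x1; rewrite -linear_sum -[leRHS](state_cst _ st).
apply: state_le => // t.
rewrite contSpace_sumE contSpaceE.
under eq_bigr do rewrite fourth_powerE contSpace_sumE.
have := @rademacher_fourth_moment R 'I_n (x ^~ t) _ (index_enum_uniq _).
move=> /le_trans; apply; rewrite ler_wpM2r// ler_piMr// expr_le1//.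
by apply: sumr_ge0 => i _; exact: sqr_ge0.
Qed.

(** Averaging [truncation_bound] over f = sum_i e_i x_i and using cotype 2 gives
the constant c K (M a + 2 A / a) for every height a; the choice a = 4 c K turns
the coefficient of A into 1 / 2. *)
Lemma summing_bound_improve T A : 0 < A -> sup_bounded T ->
  summing_bound (q:=q) T A ->
  summing_bound (q:=q) T (A / 2 + 4 * c ^+ 2 * K ^+ 2 * M).
Proof.
move=> A0 TM TA s s1.
have [phi st Tphi] := pietsch_functional qY A0 TA.
have K0 : 0 < K := lt_le_trans ltr01 K1.
pose a := 4 * c * K.
have a0 : 0 < a by rewrite !mulr_gt0.
pose x (i : 'I_(size s)) : C := nth 0 s i.
have x1 t : \sum_(i < size s) x i t ^+ 2 <= 1.
  by have := s1 t; rewrite (big_nth 0) big_mkord.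
rewrite (big_nth 0) big_mkord; apply: le_trans (cq (T \o x)) _.
set N : R := #|{ffun 'I_(size s) -> bool}|%:R.
have N0 : 0 < N by rewrite ltr0n; apply/card_gt0P; exists [ffun=> true].
have avg : sign_average q (T \o x) <= K * (M * a + 2 * (A / a)).
  rewrite /sign_average -/N ler_pdivrMl//.
  set b := A / a; set k : R := K * (M * a + b / 2).
  have Tle (e : {ffun 'I_(size s) -> bool}) :
      q (\sum_(i < size s) (-1) ^+ e i *: (T \o x) i) <=
      k + K * (b / 2) *
        phi (fourth_power (\sum_(i < size s) (-1) ^+ e i *: x i)).
    rewrite (_ : \sum_(i < size s) _ =
      T (\sum_(i < size s) (-1) ^+ e i *: x i)); last first.
      by rewrite linear_sum; apply: eq_bigr => i _; rewrite linearZ.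
    apply: le_trans (truncation_bound _ A0 a0 TM st Tphi) _.
    by rewrite /k /b; lra.
  apply: le_trans (ler_sum _ (fun e _ => Tle e)) _.
  rewrite big_split/= sumr_const -mulr_natr -/N -mulr_sumr.
  have b0 : 0 <= K * (b / 2) by rewrite !mulr_ge0 ?invr_ge0 ?ltW.
  have := ler_wpM2l b0 (state_average_fourth_power st x1); rewrite -/N /k.
  by lra.
have avg0 : 0 <= sign_average q (T \o x).
  rewrite /sign_average mulr_ge0 ?invr_ge0 ?(ltW N0)//.
  by apply: sumr_ge0 => e _; exact: (qnorm_ge0 qY).
rewrite ler_pXn2r ?nnegrE ?(mulr_ge0 (ltW c0) avg0)//; last first.
  by rewrite addr_ge0 ?mulr_ge0 ?sqr_ge0 ?ltW.
apply: le_trans (ler_wpM2l (ltW c0) avg) _; rewrite /a le_eqVlt; apply/orP; left.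
by apply/eqP; field; rewrite !gt_eqF.
Qed.

(** The infimum of the admissible constants is at most half of itself plus 4 c^2
K^2 M. The summand 1 makes up for the infimum being approached but possibly not
attained by positive constants. *)
Lemma summing_bound_uniform T A : 0 < A -> sup_bounded T ->
  summing_bound (q:=q) T A ->
  summing_bound (q:=q) T (8 * c ^+ 2 * K ^+ 2 * M + 1).
Proof.
move=> A0 TM TA; set D := 8 * c ^+ 2 * K ^+ 2 * M.
pose S := [set A | 0 < A /\ summing_bound (q:=q) T A].
have hS : has_inf S by split; [exists A|exists 0 => B [/ltW]].
have infS : inf S <= D.
  rewrite -(ler_pM2l (_ : 0 < 2^-1)) ?invr_gt0//.
  suff : inf S <= inf S / 2 + D / 2 by lra.
  apply/ler_addgt0Pr => e e0; have [B [B0 TB] Be] := inf_adherent e0 hS.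
  suff : inf S <= B / 2 + D / 2 by lra.
  rewrite (_ : D / 2 = 4 * c ^+ 2 * K ^+ 2 * M); last by rewrite /D; field.
  apply: (ge_inf hS.2); split; last exact: summing_bound_improve.
  have K0 : 0 < K := lt_le_trans ltr01 K1.
  by rewrite addr_gt0 ?divr_gt0// !mulr_gt0 ?exprn_gt0.
have [B [B0 TB] BD] := inf_adherent ltr01 hS.
move=> s s1; apply: le_trans (TB s s1) _.
have BD1 : B <= D + 1 by lra.
by rewrite ler_pXn2r// nnegrE; [exact: ltW|exact: le_trans (ltW B0) BD1].
Qed.

End Extrapolation.

(** * Approximation by finite-rank operators *)

Lemma continuous_sumr {R : realType} {T : topologicalType} {I : Type} (s : seq I)
    (F : I -> T -> R) : (forall i, continuous (F i)) ->
  continuous (fun t => \sum_(i <- s) F i t).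
Proof.
move=> Fc; elim: s => [|i s IH] t.
  rewrite (_ : (fun t => _) = fun=> 0); first exact: cvg_cst.
  by apply/funext => u; rewrite big_nil.
rewrite (_ : (fun t => _) = fun t => F i t + \sum_(j <- s) F j t).
  by apply: cvgD; [exact: Fc|exact: IH].
by apply/funext => u; rewrite big_cons.
Qed.

Section FiniteRank.
Context {R : realType} {Omega : ptopologicalType} {cO : compact [set: Omega]}.
Local Notation C := (contSpace R cO).
Implicit Types (s : seq C) (f : C) (r : seq (Omega * C)).

(** The finite-rank operator that evaluates [f] at the points [p.1] and
interpolates with the functions [p.2]. *)
Definition sample r f : C := \sum_(p <- r) f p.1 *: p.2.

Lemma sampleE r f t : sample r f t = \sum_(p <- r) f p.1 * p.2 t.
Proof. by rewrite contSpace_sumE. Qed.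

Lemma sample_linear r : linear (sample r).
Proof.
move=> a f g; rewrite /sample scaler_sumr -big_split/=; apply: eq_bigr => p _.
by rewrite !contSpaceE scalerDl scalerA.
Qed.

HB.instance Definition _ r := GRing.isLinear.Build R C C *:%R (sample r)
  (sample_linear r).

Definition partition_of_unity r :=
  (forall p t, p \in r -> 0 <= p.2 t) /\ (forall t, \sum_(p <- r) p.2 t = 1).

Lemma sample_le r f b : partition_of_unity r ->
  (forall t, `|f t| <= b) -> forall t, `|sample r f t| <= b.
Proof.
move=> [r0 r1] fb t; rewrite sampleE -[b]mulr1 -(r1 t) mulr_sumr.
apply: le_trans (ler_norm_sum _ _ _) _; rewrite big_seq [leRHS]big_seq.
apply: ler_sum => p pr; rewrite normrM (ger0_norm (r0 _ _ pr)).
by rewrite ler_wpM2r// r0.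
Qed.

(** The functions max (0, d - sum_(x in s) |x - x u|), for points [u] of a
finite subcover, are positive only where every [x] in [s] is within [d] of its
value at [u]; dividing by their sum yields the partition. *)
Lemma exists_partition_of_unity s (d : R) : 0 < d ->
  exists2 r, partition_of_unity r &
    forall x, x \in s -> forall t, `|x t - sample r x t| <= d.
Proof.
move=> d0.
pose osc u t := \sum_(x <- s) `|x t - x u|.
have osc_cont u : continuous (osc u).
  apply: continuous_sumr => x t; apply: cvg_norm.
  by apply: cvgB; [exact: contSpace_continuous|exact: cvg_cst].
have osc_ge x u t : x \in s -> `|x t - x u| <= osc u t.
  by move=> xs; rewrite /osc (big_rem x)//= lerDl; apply: sumr_ge0.
pose h u : C := contSpace_max (contSpace_cst 0)
  (contSpace_cst d - contSpace_of (osc_cont u)).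
have hE u t : h u t = Num.max 0 (d - osc u t) by rewrite !contSpaceE.
have h0 u t : 0 <= h u t by rewrite hE le_max lexx.
have h_supp u t : 0 < h u t -> osc u t < d.
  by rewrite hE lt_max ltxx/= subr_gt0.
have [D _ Dcover] : finite_subset_cover [set: Omega]
    (fun u => [set t | 0 < h u t]) [set: Omega].
  have cover : cover_compact [set: Omega] by rewrite -compact_cover.
  apply: cover.
    move=> u _; apply: (@open_comp _ _ (h u) [set x : R | 0 < x]).
      by move=> t _; exact: contSpace_continuous.
    exact: open_gt.
  move=> t _; exists t => //=; rewrite hE lt_max; apply/orP; right.
  by rewrite /osc big1 ?subr0// => x _; rewrite subrr normr0.
pose E : seq Omega := finmap.enum_fset D.
pose H t := \sum_(u <- E) h u t.
have H0 t : 0 < H t.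
  have [u /= uD ut] := Dcover t I.
  by rewrite /H (big_rem u uD)/= ltr_pwDl// sumr_ge0.
have psi_cont u : continuous (fun t => h u t / H t).
  move=> t; apply: cvgM; first exact: contSpace_continuous.
  apply: cvgV; first by rewrite gt_eqF.
  by apply: continuous_sumr => v; exact: contSpace_continuous.
pose psi u : C := contSpace_of (psi_cont u).
have psiE u t : psi u t = h u t / H t by [].
pose r := [seq (u, psi u) | u <- E].
have psi0 u t : 0 <= psi u t by rewrite psiE divr_ge0// ltW.
have psi1 t : \sum_(p <- r) p.2 t = 1.
  rewrite big_map (eq_bigr (fun u => h u t / H t))// -mulr_suml.
  by rewrite -/(H t) divff// gt_eqF// H0.
exists r; first by split=> [p t /mapP[u _ ->]|t]; [exact: psi0|exact: psi1].
move=> x xs t; rewrite sampleE -[x t]mulr1 -[in x t * 1](psi1 t) mulr_sumr -sumrB.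
apply: le_trans (ler_norm_sum _ _ _) _; rewrite -[leRHS]mulr1 -[in leRHS](psi1 t).
rewrite mulr_sumr !big_map; apply: ler_sum => u _ /=.
rewrite -mulrBl normrM (ger0_norm (psi0 u t)).
have [ut|ut] := ltP 0 (h u t).
  by rewrite ler_wpM2r// (le_trans (osc_ge _ _ _ xs))// ltW// h_supp.
have -> : psi u t = 0.
  by rewrite psiE (_ : h u t = 0) ?mul0r//; apply/eqP; rewrite eq_le ut h0.
by rewrite !mulr0.
Qed.

End FiniteRank.

Section TwoSumming.
Context {R : realType} {Omega : ptopologicalType} {cO : compact [set: Omega]}.
Local Notation C := (contSpace R cO).
Context {Y : lmodType R} {q : Y -> R} (qY : quasi_banach_norm q).
Context {K c M : R} (K1 : 1 <= K) (c0 : 0 < c) (M0 : 0 < M).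
Hypothesis Kq : forall y z, q (y + z) <= K * (q y + q z).
Hypothesis cq : forall n (y : 'I_n -> Y),
  \sum_(i < n) q (y i) ^+ 2 <= (c * sign_average q y) ^+ 2.
Implicit Types (s : seq C) (T : {linear C -> Y}) (f : C).

(** [T \o sample r] depends on a function only through its values at finitely
many points, and sum_i x_i(u)^2 <= 1 at each of them. *)
Lemma summing_bound_finite_rank T (r : seq (Omega * C)) :
  exists2 A : R, 0 < A & summing_bound (q:=q) (T \o sample r) A.
Proof.
pose n := size r; pose W := \sum_(p <- r) q (T p.2).
have W0 : 0 <= W by apply: sumr_ge0 => p _; exact: (qnorm_ge0 qY).
have K0 : 0 < K := lt_le_trans ltr01 K1.
pose B := K ^+ n * W.
have B0 : 0 <= B by rewrite mulr_ge0// exprn_ge0// ltW.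
have Tx x : q (T (sample r x)) ^+ 2 <= B ^+ 2 * \sum_(p <- r) x p.1 ^+ 2.
  set S := \sum_(p <- r) _.
  have S0 : 0 <= S by apply: sumr_ge0 => p _; exact: sqr_ge0.
  rewrite -[S]sqr_sqrtr// -exprMn ler_pXn2r ?nnegrE ?(qnorm_ge0 qY)//; last first.
    by rewrite mulr_ge0// sqrtr_ge0.
  rewrite linear_sum; apply: le_trans (quasi_norm_sum qY r _ K1 Kq) _.
  rewrite -/n -mulrA ler_wpM2l ?(exprn_ge0 _ (ltW K0))// mulrC mulr_sumr.
  rewrite big_seq [leRHS]big_seq; apply: ler_sum => p pr.
  rewrite linearZ (qnormZ qY) ler_wpM2r ?(qnorm_ge0 qY)//.
  rewrite -sqrtr_sqr ler_sqrt// /S (big_rem p)//= lerDl.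
  by apply: sumr_ge0 => ? _; exact: sqr_ge0.
exists ((1 + B) * n.+1%:R); first by rewrite mulr_gt0 ?ltr0n// ltr_pwDl.
move=> s s1; apply: le_trans (ler_sum _ (fun x _ => Tx x)) _.
rewrite -mulr_sumr exchange_big/= [leRHS]exprMn.
apply: ler_pM; rewrite ?sqr_ge0//.
- by apply: sumr_ge0 => p _; apply: sumr_ge0 => x _; exact: sqr_ge0.
- by rewrite ler_pXn2r ?nnegrE ?addr_ge0// lerDr.
- apply: (@le_trans _ _ n.+1%:R); last by rewrite -natrX ler_nat leq_pmulr.
  apply: le_trans (ler_sum _ (fun p _ => s1 p.1)) _.
  by rewrite big_const_seq count_predT iter_addr_0 ler_nat.
Qed.

(** [summing_bound_uniform] applies to [T \o sample r] with a constant
independent of [r], and for a given family [r] can be chosen so that sampling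
moves each member by at most 1 / (n + 1), with n the length of the family: the n
error terms M^2 / (n + 1)^2 sum to at most M^2. *)
Lemma summing_bound_bounded T : sup_bounded (q:=q) (M:=M) T ->
  exists2 A : R, 0 < A & summing_bound (q:=q) T A.
Proof.
move=> TM; pose B := 8 * c ^+ 2 * K ^+ 2 * M + 1.
have K0 : 0 < K := lt_le_trans ltr01 K1.
have B0 : 0 < B by rewrite addr_gt0// !mulr_gt0 ?exprn_gt0.
exists (2 * K * (B + M)); first by rewrite !mulr_gt0// addr_gt0.
move=> s s1; pose n : R := (size s)%:R; pose d := (n + 1)^-1.
have n0 : 0 <= n by rewrite ler0n.
have d0 : 0 < d by rewrite invr_gt0; lra.
have [r rP sr] := exists_partition_of_unity s d0.
have rM : sup_bounded (q:=q) (M:=M) (T \o sample r).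
  by move=> f b fb; apply: TM; exact: sample_le.
have [A A0 TA] := summing_bound_finite_rank T r.
have TB := summing_bound_uniform qY K1 c0 M0 Kq cq A0 rM TA.
have Tx x : x \in s -> q (T x) ^+ 2 <=
    2 * K ^+ 2 * (q (T (sample r x)) ^+ 2 + (M * d) ^+ 2).
  move=> xs.
  have Txd : q (T (x - sample r x)) <= M * d.
    by apply: TM => t; rewrite contSpaceDE contSpaceNE; exact: sr.
  have := Kq (T (sample r x)) (T (x - sample r x)).
  rewrite -linearD addrC subrK.
  set a := q (T (sample r x)) => le1.
  have a0 : 0 <= a by exact: (qnorm_ge0 qY).
  have Md : 0 <= M * d by rewrite mulr_ge0 ?ltW.
  apply: (@le_trans _ _ ((K * (a + M * d)) ^+ 2)).
    have aMd : 0 <= K * (a + M * d) by rewrite mulr_ge0 ?addr_ge0// ltW.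
    rewrite ler_pXn2r ?nnegrE ?(qnorm_ge0 qY)//.
    by apply: le_trans le1 _; rewrite ler_wpM2l ?lerD2l// ltW.
  rewrite [leRHS](_ : _ = K ^+ 2 * (2 * (a ^+ 2 + (M * d) ^+ 2))); last by ring.
  rewrite [leLHS]exprMn ler_wpM2l ?sqr_ge0//.
  by have := sqr_ge0 (a - M * d); rewrite !expr2; lra.
rewrite big_seq; apply: le_trans (ler_sum _ Tx) _.
rewrite -big_seq -mulr_sumr big_split/= big_const_seq count_predT iter_addr_0.
have S1 : \sum_(x <- s) q (T (sample r x)) ^+ 2 <= B ^+ 2 by exact: TB.
have S2 : (M * d) ^+ 2 *+ size s <= M ^+ 2.
  rewrite -mulr_natr exprMn -mulrA ler_piMr ?sqr_ge0// -/n /d exprVn.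
  by rewrite ler_pdivrMl ?mulr1 ?exprn_gt0 ?ltr_wpDl//; nra.
have K20 : 0 <= K ^+ 2 := sqr_ge0 K.
apply: (@le_trans _ _ (2 * K ^+ 2 * (B ^+ 2 + M ^+ 2))).
  by apply: ler_wpM2l; [rewrite mulr_ge0|exact: lerD].
rewrite -subr_ge0 [leRHS](_ : _ =
  2 * (K ^+ 2 * (B ^+ 2 + M ^+ 2)) + 8 * (K ^+ 2 * (B * M))); last by ring.
have BM : 0 <= B * M by rewrite mulr_ge0// ltW.
have h1 := mulr_ge0 K20 (addr_ge0 (sqr_ge0 B) (sqr_ge0 M)).
have h2 := mulr_ge0 K20 BM.
exact: addr_ge0 (mulr_ge0 (ler0n _ 2) h1) (mulr_ge0 (ler0n _ 8) h2).
Qed.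

End TwoSumming.

(** * The outer measure of a state *)

Section RieszContent.
Context {R : realType} {Omega : ptopologicalType} {cO : compact [set: Omega]}.
Local Notation C := (contSpace R cO).
Context (hO : hausdorff_space Omega) {phi : {scalar C}} (st : is_state phi).
Implicit Types (U V : set Omega) (f g : C).

(** Vanishing off [U] replaces the condition of support inside [U]; [lower e]
recovers the margin that compactness arguments need, at a cost of [e]. *)
Definition subordinate U : set C :=
  [set f | (forall t, 0 <= f t <= 1) /\ (forall t, ~ U t -> f t = 0)].

Definition inner_content U : R := sup [set phi f | f in subordinate U].

Lemma subordinateS U V f : U `<=` V -> subordinate U f -> subordinate V f.
Proof. by move=> UV [f01 fU]; split=> // t nVt; apply: fU => /UV. Qed.

Lemma subordinate0 U : subordinate U 0.
Proof. by split=> // t; rewrite contSpaceE lexx ler01. Qed.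

Lemma inner_content_has_sup U : has_sup [set phi f | f in subordinate U].
Proof.
split; first by exists (phi 0); exists 0 => //; exact: subordinate0.
exists 1 => _ [f [f01 _] <-]; rewrite -(state_cst 1 st); apply: state_le => // t.
by rewrite contSpaceE; case/andP: (f01 t).
Qed.

Lemma inner_content_ge U f : subordinate U f -> phi f <= inner_content U.
Proof.
by move=> Uf; apply: (ub_le_sup (inner_content_has_sup U).2); exists f.
Qed.

Lemma inner_content_le U b : (forall f, subordinate U f -> phi f <= b) ->
  inner_content U <= b.
Proof.
move=> Ub; apply: ge_sup; first exact: (inner_content_has_sup U).1.
by move=> _ [f Uf <-]; exact: Ub.
Qed.

Lemma inner_content_ge0 U : 0 <= inner_content U.
Proof.
by rewrite -(linear0 phi); apply: inner_content_ge; exact: subordinate0.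
Qed.

Lemma inner_content_mono U V : U `<=` V -> inner_content U <= inner_content V.
Proof.
by move=> UV; apply: inner_content_le => f /(subordinateS UV)/inner_content_ge.
Qed.

Lemma inner_content_set0 : inner_content set0 = 0.
Proof.
apply/eqP; rewrite eq_le inner_content_ge0 andbT; apply: inner_content_le.
move=> f [_ f0]; rewrite (_ : f = 0) ?linear0//.
by apply: contSpaceP => t; apply: f0.
Qed.

Lemma inner_content_setT : inner_content setT = 1.
Proof.
apply/eqP; rewrite eq_le; apply/andP; split.
  apply: inner_content_le => f [f01 _]; rewrite -(state_cst 1 st).
  by apply: state_le => // t; rewrite contSpaceE; case/andP: (f01 t).
rewrite -{1}(state_cst 1 st); apply: inner_content_ge.
by split=> [t|t []//]; rewrite contSpaceE ler01 lexx.
Qed.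

(** [lower e f] is nonzero only on the closed, hence compact, set where f >= e.
*)
Definition lower (e : R) f : C :=
  contSpace_max (contSpace_cst 0) (f - contSpace_cst e).

Lemma lowerE e f t : lower e f t = Num.max 0 (f t - e).
Proof. by rewrite !contSpaceE. Qed.

Lemma state_lower e f : phi f <= phi (lower e f) + e.
Proof.
rewrite -[X in _ <= _ + X](state_cst _ st) -linearD; apply: state_le => // t.
by rewrite contSpaceE lowerE contSpaceE -lerBlDr le_max lexx orbT.
Qed.

Lemma subordinate_lower U V e f : 0 < e -> subordinate U f ->
  (forall t, e <= f t -> V t) -> subordinate V (lower e f).
Proof.
move=> e0 [f01 fU] fV; split=> t.
  by rewrite lowerE le_max lexx ge_max; case/andP: (f01 t); lra.
move=> nVt; rewrite lowerE; apply/max_idPl.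
by have [/fV//|] := leP e (f t); lra.
Qed.

Lemma closed_superlevel e f : closed [set t | e <= f t].
Proof.
apply: (@preimage_closed _ _ f [set x | e <= x]); last exact: closed_ge.
by move=> t _; exact: contSpace_continuous.
Qed.

Lemma open_superlevel e f : open [set t | e < f t].
Proof.
apply: (@open_comp _ _ f [set x | e < x]); last exact: open_gt.
by move=> t _; exact: contSpace_continuous.
Qed.

(** The closed sets [A] and [B], where f >= e outside [U] and outside [V], are
disjoint. A Urysohn function h with value 0 on [A] and 1 on [B] splits [lower e
f] into [lower e f] * h, which vanishes off [U], and [lower e f] * (1 - h),
which vanishes off [V]. *)
Lemma inner_contentU U V : open U -> open V ->
  inner_content (U `|` V) <= inner_content U + inner_content V.
Proof.
move=> oU oV; apply: inner_content_le => f UVf; apply/ler_addgt0Pr => e e0.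
pose A := [set t | e <= f t] `&` ~` U; pose B := [set t | e <= f t] `&` ~` V.
have cA : closed A.
  by apply: closedI; [exact: closed_superlevel|exact: open_closedC].
have cB : closed B.
  by apply: closedI; [exact: closed_superlevel|exact: open_closedC].
have AB0 : A `&` B = set0.
  apply/seteqP; split=> // t [[/= ef nU] [_ nV]].
  by have := UVf.2 t; rewrite /setU/= => /(_ ltac:(by case)) ft; lra.
have /(@normal_separatorP R) sep := compact_normal hO cO.
have /(@uniform_separatorP _ R) [h [ch h01 hA hB]] := sep _ _ cA cB AB0.
pose H : C := contSpace_of ch.
have {}h01 t : 0 <= h t <= 1.
  by have := h01 (h t) (imageT _ _); rewrite /= in_itv.
have l01 t : 0 <= lower e f t <= 1.
  by rewrite lowerE le_max lexx ge_max; case/andP: (UVf.1 t); lra.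
have l0 t : f t < e -> lower e f t = 0.
  by move=> fe; rewrite lowerE; apply/max_idPl; lra.
pose fU : C := contSpace_mul (lower e f) H.
pose fV : C := contSpace_mul (lower e f) (contSpace_cst 1 - H).
have fUE t : fU t = lower e f t * h t by [].
have fVE t : fV t = lower e f t * (1 - h t) by [].
have sU : subordinate U fU.
  split=> t.
    rewrite fUE; have := l01 t; have := h01 t.
    by move=> /andP[? ?] /andP[? ?]; rewrite mulr_ge0//= mulr_ile1.
  move=> nUt; rewrite fUE; have [ef|/l0 ->] := leP e (f t).
    by rewrite (hA (h t)) ?mulr0//; exists t.
  by rewrite mul0r.
have sV : subordinate V fV.
  split=> t.
    rewrite fVE; have := l01 t; have := h01 t.
    by move=> /andP[? ?] /andP[? ?]; rewrite mulr_ge0 ?mulr_ile1; lra.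
  move=> nVt; rewrite fVE; have [ef|/l0 ->] := leP e (f t).
    by rewrite (hB (h t)) ?subrr ?mulr0//; exists t.
  by rewrite mul0r.
apply: le_trans (state_lower e f) _; rewrite lerD2r.
rewrite (_ : lower e f = fU + fV).
  by rewrite linearD; apply: lerD; exact: inner_content_ge.
by apply: contSpaceP => t; rewrite [RHS]contSpaceDE fUE fVE; ring.
Qed.

Lemma open_bigsetU (F : nat -> set Omega) n : (forall i, open (F i)) ->
  open (\big[setU/set0]_(i < n) F i).
Proof. by move=> oF; elim/big_ind: _ => //; [exact: open0|exact: openU]. Qed.

Lemma inner_content_bigsetU (F : nat -> set Omega) n : (forall i, open (F i)) ->
  inner_content (\big[setU/set0]_(i < n) F i) <= \sum_(i < n) inner_content (F i).
Proof.
move=> oF; elim: n => [|n IH]; first by rewrite !big_ord0 inner_content_set0.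
rewrite !big_ord_recr/=; apply: le_trans (inner_contentU _ (oF n)) _.
  exact: open_bigsetU.
by rewrite lerD2r.
Qed.

(** For [f] subordinate to the union, the compact set where f >= e is covered by
finitely many [F i], so [lower e f] is subordinate to a finite union. *)
Lemma inner_content_bigcup (F : nat -> set Omega) : (forall i, open (F i)) ->
  ((inner_content (\bigcup_i F i))%:E <= \sum_(i <oo) (inner_content (F i))%:E)%E.
Proof.
move=> oF; set S := (\sum_(i <oo) _)%E.
have term0 i : (0 <= (inner_content (F i))%:E)%E.
  by rewrite lee_fin inner_content_ge0.
have S0 : (0 <= S)%E by apply: nneseries_ge0.
suff phiS f : subordinate (\bigcup_i F i) f -> ((phi f)%:E <= S)%E.
  move: S S0 phiS => [S| |] S0 phiS; rewrite ?leey//.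
  by rewrite lee_fin; apply: inner_content_le => f /phiS; rewrite lee_fin.
move=> Ff; apply/lee_addgt0Pr => e e0.
have cK : compact [set t | e <= f t].
  by apply: subclosed_compact cO _; [exact: closed_superlevel|].
have [D _ KD] : finite_subset_cover [set: nat] F [set t | e <= f t].
  have : cover_compact [set t | e <= f t] by rewrite -compact_cover.
  apply=> [i _|t /= et]; first exact: oF.
  have [[i _ Fit]|nF] := pselect ((\bigcup_i F i) t); first by exists i.
  by have := Ff.2 _ nF; lra.
pose n := (\max_(i <- finmap.enum_fset D) i).+1.
have lF : subordinate (\big[setU/set0]_(i < n) F i) (lower e f).
  apply: subordinate_lower Ff _ => // t /KD [i /= iD Fit].
  have ltin : (i < n)%N by rewrite ltnS; apply: (@leq_bigmax_seq _ _ xpredT id).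
  by rewrite -bigcup_mkord; exists i.
apply: (@le_trans _ _ (\sum_(i < n) inner_content (F i) + e)%:E).
  rewrite lee_fin; apply: le_trans (state_lower e f) _; rewrite lerD2r.
  exact: le_trans (inner_content_ge lF) (inner_content_bigsetU _ oF).
rewrite EFinD leeD2r// -sumEFin.
rewrite -(big_mkord xpredT (fun i => (inner_content (F i))%:E)).
exact: nneseries_lim_ge.
Qed.

Definition outer_content (A : set Omega) : R :=
  inf [set inner_content U | U in [set U | open U /\ A `<=` U]].

Lemma outer_content_has_inf A :
  has_inf [set inner_content U | U in [set U | open U /\ A `<=` U]].
Proof.
split.
  by exists (inner_content setT); exists setT => //; split=> //; exact: openT.
by exists 0 => _ [U _ <-]; exact: inner_content_ge0.
Qed.

Lemma outer_content_le A U : open U -> A `<=` U ->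
  outer_content A <= inner_content U.
Proof.
by move=> oU AU; apply: ge_inf (outer_content_has_inf A).2 _ _; exists U.
Qed.

Lemma outer_content_adherent A e : 0 < e ->
  exists U, [/\ open U, A `<=` U & inner_content U < outer_content A + e].
Proof.
move=> e0.
have [_ [U [oU AU] <-] Ue] := inf_adherent e0 (outer_content_has_inf A).
by exists U.
Qed.

Lemma outer_content_ge0 A : 0 <= outer_content A.
Proof.
apply: lb_le_inf; first exact: (outer_content_has_inf A).1.
by move=> _ [U _ <-]; exact: inner_content_ge0.
Qed.

Lemma outer_content_open U : open U -> outer_content U = inner_content U.
Proof.
move=> oU; apply/eqP; rewrite eq_le outer_content_le//=.
apply: lb_le_inf; first exact: (outer_content_has_inf U).1.
by move=> _ [V [_ UV] <-]; exact: inner_content_mono.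
Qed.

Lemma outer_content_mono A B : A `<=` B -> outer_content A <= outer_content B.
Proof.
move=> AB; apply: lb_le_inf; first exact: (outer_content_has_inf B).1.
move=> _ [U [oU BU] <-]; apply: outer_content_le => //.
exact: subset_trans AB BU.
Qed.

(** The [n]-th set is enclosed in an open set whose content exceeds its outer
content by at most e / 2^(n+1). *)
Lemma outer_content_sigma_subadditive :
  sigma_subadditive (fun A => (outer_content A)%:E).
Proof.
move=> F; apply/lee_addgt0Pr => e e0.
have choiceU n : exists U, [/\ open U, F n `<=` U &
    inner_content U < outer_content (F n) + e / (2 ^ n.+1)%:R].
  by apply: outer_content_adherent; rewrite divr_gt0// ltr0n expn_gt0.
have [U UP] := choice choiceU.
have oU n : open (U n) by have [] := UP n.
apply: (@le_trans _ _ (inner_content (\bigcup_n U n))%:E).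
  rewrite lee_fin; apply: outer_content_le; first by apply: bigcup_open => n _.
  by apply: subset_bigcup => n _; have [] := UP n.
apply: le_trans (inner_content_bigcup oU) _.
apply: le_trans (epsilon_trick _ _ (ltW e0)) => [|n]; last first.
  by rewrite lee_fin outer_content_ge0.
apply: lee_nneseries => n _; first by rewrite lee_fin inner_content_ge0.
by rewrite -EFinD lee_fin; have [_ _ /ltW] := UP n.
Qed.

(** Let [V] be open around [A], and [f] almost attain the content of [V `&` U].
As [f] vanishes off [U], the open set [W] of points of [V] where f < d / 2
contains [A `&` ~` U], and any g subordinate to [W] is zero wherever [lower (d /
2) f] is not. The sum of these two functions is therefore subordinate to [V]. *)
Lemma outer_content_open_split U A : open U ->
  outer_content (A `&` U) + outer_content (A `&` ~` U) <= outer_content A.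
Proof.
move=> oU; apply/ler_addgt0Pr => e e0.
have [V [oV AV Ve]] := outer_content_adherent A e0.
apply: le_trans _ (ltW Ve).
have AVU : outer_content (A `&` U) <= inner_content (V `&` U).
  by apply: outer_content_le; [exact: openI|exact: setSI].
suff : forall d, 0 < d ->
    inner_content (V `&` U) + outer_content (A `&` ~` U) <= inner_content V + d.
  by move=> /ler_addgt0Pr; lra.
move=> d d0; have d20 : 0 < d / 2 by rewrite divr_gt0.
suff : inner_content (V `&` U) <=
    inner_content V + d - outer_content (A `&` ~` U).
  by lra.
apply: inner_content_le => f VUf.
pose W := V `&` [set t | d / 2 < contSpace_fun (contSpace_cst d - f) t].
have oW : open W by apply: openI => //; exact: open_superlevel.
have AW : outer_content (A `&` ~` U) <= inner_content W.
  apply: outer_content_le => // t [At nUt]; split; first exact: AV.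
  by rewrite /= !contSpaceE VUf.2 ?subr0; [lra|case].
suff : inner_content W <= inner_content V + d / 2 - phi (lower (d / 2) f).
  by have := state_lower (d / 2) f; lra.
apply: inner_content_le => g Wg.
suff : phi (lower (d / 2) f + g) <= inner_content V by rewrite linearD; lra.
apply: inner_content_ge; split=> t.
  rewrite contSpaceE lowerE; have := VUf.1 t; have := Wg.1 t.
  move=> /andP[g0 g1] /andP[f0 f1].
  have [|ft] := leP (f t - d / 2) 0; first by rewrite add0r g0 g1.
  rewrite Wg.2 ?addr0; first lra.
  by move=> [_]; rewrite /= !contSpaceE; lra.
move=> nVt; rewrite contSpaceE lowerE Wg.2 ?VUf.2; [|by case|by case].
by rewrite addr0; apply/max_idPl; lra.
Qed.

End RieszContent.

(** * The representing measure *)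

Section Riesz.
Context {R : realType} {Omega : ptopologicalType} {cO : compact [set: Omega]}.
Local Notation C := (contSpace R cO).
Context (hO : hausdorff_space Omega) {phi : {scalar C}} (st : is_state phi).
Implicit Types (f g : C).

Lemma open_borel (U : set Omega) : open U ->
  measurable (U : set (borel_space Omega)).
Proof. by move=> oU; exact: sub_sigma_algebra. Qed.

Lemma continuous_borel f : measurable_fun [set: borel_space Omega] f.
Proof.
apply: (measurability _ (RGenOInfty.measurableE R)) => /= _ [_ [a ->]] <-.
rewrite setTI; apply: open_borel.
rewrite (_ : _ @^-1` _ = [set t | a < f t]); first exact: open_superlevel.
by apply/seteqP; split=> t; rewrite /= in_itv/= andbT.
Qed.

(** By [outer_content_open_split] the Caratheodory sigma-algebra contains the
open sets, hence the Borel sets, and the outer measure restricts to a measure on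
them. *)
Lemma exists_riesz_measure : exists mu : probability (borel_space Omega) R,
  forall U, open U -> mu U = (inner_content (phi:=phi) U)%:E.
Proof.
pose nu (A : set Omega) : \bar R := (outer_content (phi:=phi) A)%:E.
have nu0 : nu set0 = 0%E.
  by rewrite /nu outer_content_open ?inner_content_set0//; exact: open0.
have nu_ge0 A : (0 <= nu A)%E by rewrite lee_fin outer_content_ge0.
have nu_mono : {homo nu : A B / A `<=` B >-> (A <= B)%E}.
  by move=> A B AB; rewrite lee_fin outer_content_mono.
pose om : {outer_measure set Omega -> \bar R} := HB.pack nu
  (isOuterMeasure.Build R Omega nu nu0 nu_ge0 nu_mono
    (outer_content_sigma_subadditive hO st)).
have borel_cara (A : set Omega) :
    measurable (A : set (borel_space Omega)) -> om.-cara.-measurable A.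
  apply: smallest_sub; first exact: sigma_algebra_measurable.
  move=> U oU; apply: le_caratheodory_measurable => X.
  by rewrite /= /nu -EFinD lee_fin outer_content_open_split.
have nu_sigma : semi_sigma_additive (nu : set (borel_space Omega) -> \bar R).
  move=> F mF tF mUF.
  apply: (caratheodory_measure_sigma_additive (mu := om)) => //.
    by move=> i; exact: borel_cara.
  exact: borel_cara.
pose m : {measure set (borel_space Omega) -> \bar R} :=
  HB.pack (nu : set (borel_space Omega) -> \bar R)
  (isMeasure.Build _ (borel_space Omega) R nu nu0 nu_ge0 nu_sigma).
have m1 : m setT = 1%E.
  by rewrite /= /nu outer_content_open ?inner_content_setT//; exact: openT.
pose P : probability (borel_space Omega) R :=
  HB.pack (nu : set (borel_space Omega) -> \bar R) (Measure.class m)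
    (Measure_isProbability.Build _ _ _ m m1).
by exists P => U oU; rewrite /= /nu outer_content_open.
Qed.

Lemma sum_clamp (x : R) n : 0 <= x ->
  \sum_(k < n) Num.min 1 (Num.max 0 (x - k%:R)) = Num.min x n%:R.
Proof.
move=> x0; elim: n => [|n IH]; first by rewrite big_ord0 min_r.
rewrite big_ord_recr/= IH -natr1; case: (leP x n%:R) => xn.
  rewrite (max_l (_ : x - n%:R <= 0)); last by lra.
  by rewrite (min_r ler01) (min_l (_ : x <= n%:R + 1)); lra.
rewrite max_r; last by lra.
case: (leP 1 (x - n%:R)) => xn1.
  by rewrite (min_r (_ : n%:R + 1 <= x)); lra.
by rewrite (min_l (_ : x <= n%:R + 1)); lra.
Qed.

Lemma sum_levels_le (x : R) n : 0 <= x ->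
  \sum_(k < n) (k%:R < x)%R%:R <= x + 1.
Proof.
move=> x0; suff : \sum_(k < n) (k%:R < x)%R%:R <= Num.min (x + 1) n%:R.
  by rewrite le_min => /andP[].
elim: n => [|n]; first by rewrite big_ord0 le_min lexx; lra.
rewrite big_ord_recr/= -natr1 !le_min => /andP[Sx Sn].
by case: (ltP n%:R x) => nx /=; lra.
Qed.

(** A layer cake estimate. In steps of height e, g is e times the sum of the
clamped functions h_k = min (1, max (0, g / e - k)), and h_k is subordinate to
U_k = {g > k e}. So phi g <= e sum_k mu(U_k), which is the integral of e sum_k
1_(U_k) <= g + e. *)
Lemma riesz_measure_ge (mu : probability (borel_space Omega) R) g :
  (forall U, open U -> mu U = (inner_content (phi:=phi) U)%:E) ->
  (forall t, 0 <= g t) -> ((phi g)%:E <= \int[mu]_t (g t)%:E)%E.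
Proof.
move=> muE g0; apply/lee_addgt0Pr => e e0.
pose n := (Num.truncn (`|g| / e)).+1.
have gn t : g t / e <= n%:R.
  apply: (@le_trans _ _ (`|g| / e)); last exact/ltW/truncnS_gt.
  rewrite ler_wpM2r ?invr_ge0 ?(ltW e0)//.
  exact: le_trans (ler_norm _) (sup_norm_ub g t).
pose U (k : nat) := [set t | k%:R * e < g t].
pose h (k : nat) : C := contSpace_min (contSpace_cst 1) (lower k%:R (e^-1 *: g)).
have hE k t : h k t = Num.min 1 (Num.max 0 (g t / e - k%:R)).
  by rewrite [g t / e]mulrC.
have hU k : subordinate (U k) (h k).
  split=> t; rewrite hE; first by rewrite le_min ler01 le_max lexx ge_min lexx.
  move=> /negP; rewrite -leNgt -ler_pdivrMr// => gk.
  by rewrite max_l ?min_r//; lra.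
have gE : g = e *: \sum_(k < n) h k.
  apply: contSpaceP => t; rewrite contSpaceZE contSpace_sumE.
  under eq_bigr do rewrite hE.
  by rewrite sum_clamp ?divr_ge0 ?(ltW e0)// min_l// mulrC divfK// gt_eqF.
have oU k : open (U k) by exact: open_superlevel.
have mU k : measurable (U k : set (borel_space Omega)) by exact: open_borel.
apply: (@le_trans _ _ (\sum_(k < n) e%:E * mu (U k))%E).
  rewrite gE linearZ linear_sum/= mulr_sumr -sumEFin; apply: lee_sum => k _.
  rewrite muE// -EFinM lee_fin ler_wpM2l ?(ltW e0)//.
  exact: inner_content_ge.
apply: (@le_trans _ _ (\int[mu]_t (\sum_(k < n) e%:E * (\1_(U k) t)%:E))%E).
  rewrite ge0_integral_sum//=; last 2 first.
  - move=> k; apply: measurable_funeM; apply/measurable_EFinP.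
    exact: measurable_indic.
  - by move=> k t _; rewrite -EFinM lee_fin mulr_ge0// ltW.
  apply: lee_sum => k _; rewrite ge0_integralZl//.
  - by rewrite integral_indic// setIT.
  - by apply/measurable_EFinP; exact: measurable_indic.
  - by rewrite lee_fin ltW.
have mg : measurable_fun [set: borel_space Omega] (EFin \o g).
  by apply/measurable_EFinP; exact: continuous_borel.
rewrite -[leRHS](_ : \int[mu]_t ((g t)%:E + e%:E) = _)%E; last first.
  rewrite ge0_integralD//; last by move=> t _; rewrite lee_fin ltW.
    rewrite integral_cst// -[in RHS](mule1 e%:E); congr (_ + _ * _)%E.
    exact: probability_setT.
  by move=> t _; rewrite lee_fin.
apply: ge0_le_integral => //.
- by move=> t _; apply: sume_ge0 => k _; rewrite -EFinM lee_fin mulr_ge0// ltW.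
- by apply: emeasurable_sum => k; apply: measurable_funeM; apply/measurable_EFinP;
  exact: measurable_indic.
- by apply: emeasurable_funD.
move=> t _; under eq_bigr do rewrite -EFinM.
rewrite sumEFin -EFinD lee_fin -mulr_sumr.
have -> : \sum_(k < n) \1_(U k) t = \sum_(k < n) (k%:R < g t / e)%R%:R :> R.
  apply: eq_bigr => k _; rewrite indicE; congr (_%:R); congr (nat_of_bool _).
  by apply/idP/idP; rewrite inE /U /= ltr_pdivlMr.
rewrite -ler_pdivlMl// mulrDr mulVf ?gt_eqF// mulrC [_^-1 * _]mulrC.
by rewrite sum_levels_le// divr_ge0// ltW.
Qed.

End Riesz.

(** * Two-summing operators and domination *)

Section Conclusions.
Context {R : realType} {Omega : ptopologicalType} {cO : compact [set: Omega]}.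
Local Notation C := (contSpace R cO).
Context {Y : lmodType R} {q : Y -> R} (qY : quasi_banach_norm q).
Implicit Types (T : {linear C -> Y}) (A : R).

Definition evaluation (t : Omega) (f : C) : R := f t.

Lemma evaluation_linear t : linear_for *%R (evaluation t).
Proof. by move=> a f g; rewrite /evaluation !contSpaceE. Qed.

HB.instance Definition _ t := GRing.isLinear.Build R C R *%R (evaluation t)
  (evaluation_linear t).

(** Point evaluations belong to the unit ball of the dual. *)
Lemma evaluations_le_weak_l2_norm n (x : 'I_n -> C) t :
  Num.sqrt (\sum_(i < n) x i t ^+ 2) <= weak_l2_norm x.
Proof.
set S := [set Num.sqrt (\sum_(i < n) `|(phi : {scalar C}) (x i)| ^+ 2)
      | phi in @dual_unit_ball R C].
have S_ub : has_ubound S.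
  exists (Num.sqrt (\sum_(i < n) `|x i| ^+ 2)) => _ [phi phi1 <-].
  apply: ler_wsqrtr; apply: ler_sum => i _.
  by rewrite ler_pXn2r ?nnegrE//; exact: phi1.
apply: (ub_le_sup S_ub); pose ev : {scalar C} := evaluation t.
exists ev; first by move=> f; exact: sup_norm_ub.
by congr Num.sqrt; apply: eq_bigr => i _; rewrite real_normK ?num_real.
Qed.

Lemma summing_bound_two_absolutely_summing T A : 0 < A ->
  summing_bound (q:=q) T A -> two_absolutely_summing q T.
Proof.
move=> A0 TA; exists A => n x.
have w_ge0 : 0 <= weak_l2_norm x.
  exact: le_trans (sqrtr_ge0 _) (evaluations_le_weak_l2_norm x point).
have S0 : 0 <= \sum_(i < n) q (T (x i)) ^+ 2.
  by apply: sumr_ge0 => i _; exact: sqr_ge0.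
rewrite -(@ler_pXn2r _ 2) ?nnegrE ?sqrtr_ge0 ?(mulr_ge0 (ltW A0) w_ge0)//.
rewrite sqr_sqrtr// exprMn.
have := summing_boundZ (s := [seq x i | i <- index_enum 'I_n]) qY TA.
rewrite big_map; apply => t; rewrite big_map.
have xt0 : 0 <= \sum_(i < n) x i t ^+ 2.
  by apply: sumr_ge0 => i _; exact: sqr_ge0.
rewrite -(sqr_sqrtr xt0) ler_pXn2r ?nnegrE ?sqrtr_ge0//.
exact: evaluations_le_weak_l2_norm.
Qed.

Lemma summing_bound_domination (hO : hausdorff_space Omega) T A : 0 < A ->
  summing_bound (q:=q) T A ->
  exists mu : probability (borel_space Omega) R, forall f : C,
    ((q (T f))%:E <= A%:E * 'N[mu]_(2%:E) [EFin \o f])%E.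
Proof.
move=> A0 TA; have [phi st Tphi] := pietsch_functional qY A0 TA.
have [mu muE] := exists_riesz_measure hO st; exists mu => f.
have N2 : ('N[mu]_(2%:E) [EFin \o f] `^ 2 =
    \int[mu]_t (contSpace_mul f f t)%:E)%E.
  rewrite poweR_Lnorm//; apply: eq_integral => t _ /=.
  by rewrite powR_mulrn// real_normK ?num_real// expr2.
have := Lnorm_ge0 mu 2%:E (EFin \o f).
have : ((phi (contSpace_mul f f))%:E <= \int[mu]_t (contSpace_mul f f t)%:E)%E.
  by apply: (riesz_measure_ge st muE) => t; rewrite contSpaceE -expr2 sqr_ge0.
rewrite -N2; case: ('N[mu]_(2%:E) [EFin \o f])%E => [r| |]//=.
- rewrite !lee_fin => phi_le r0; rewrite powR_mulrn// in phi_le.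
  rewrite -(@ler_pXn2r _ 2) ?nnegrE ?(qnorm_ge0 qY) ?mulr_ge0 ?(ltW A0)//.
  by apply: le_trans (Tphi f) _; rewrite exprMn ler_wpM2l ?sqr_ge0.
- by move=> _ _; rewrite gt0_muley ?lte_fin// leey.
Qed.

End Conclusions.

Theorem theorem4p3 (R : realType)
    (Omega : ptopologicalType) (cO : compact [set: Omega])
    (hO : hausdorff_space Omega)
    (Y : lmodType R) (q : Y -> R) (qY : quasi_banach_norm q)
    (cotypeY : has_cotype q 2)
    (T : {linear contSpace R cO -> Y}) (bT : bounded_operator q T) :
  two_absolutely_summing q T /\
  exists (mu : probability (borel_space Omega) R) (C : R),
    forall f : contSpace R cO,
      ((q (T f))%:E <= C%:E * 'N[mu]_(2%:E) [EFin \o f])%E.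
Proof.
have [M0 TM0] := bT; pose M := Num.max 1 M0.
have M_gt0 : 0 < M by rewrite lt_max ltr01.
have TM : sup_bounded (q:=q) (M:=M) T.
  move=> f b fb; apply: le_trans (TM0 f) _.
  apply: (@le_trans _ _ (M * `|f|)).
    by rewrite ler_wpM2r// le_max lexx orbT.
  by rewrite ler_wpM2l ?(ltW M_gt0)//; exact: sup_norm_le.
have [K K1 Kq] := quasi_triangle_ge1 qY.
have [c c0 cq] := cotype2_sum_sqr qY cotypeY.
have [A A0 TA] := summing_bound_bounded qY K1 c0 M_gt0 Kq cq TM.
split; first exact: summing_bound_two_absolutely_summing TA.
by have [mu muT] := summing_bound_domination qY hO A0 TA; exists mu, A.
Qed.
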